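(* Let $\{X_n\}$ be a sequence of finite dimensional Banach spaces with property (co). Then $c_0(X_n)$ has property CWO.
   Context: Banach spaces are over the scalar field $\mathbb K$, where $\mathbb K=\mathbb R$ or $\mathbb K=\mathbb C$. $B_X$ denotes the closed unit ball of a Banach space $X$, and $B(x,\delta)=\{y\in X:\|y-x\|<\delta\}$. For a sequence $\{X_n\}$ of Banach spaces, $c_0(X_n)$ is the Banach space of all sequences $(x_n)$ with $x_n\in X_n$ and $\|x_n\|\to0$, with norm $\|(x_n)\|=\sup_n\|x_n\|$. A finite convex combination of relatively weakly open subsets of $B_X$ is a set $C=\sum_{j=1}^n\lambda_jU_j=\{\sum_{j=1}^n\lambda_ju_j: u_j\in U_j\}$, where $n\in\mathbb N$, each $U_j\subset B_X$ is open in the relative weak topology of $B_X$, $\lambda_j>0$ and $\sum_{j=1}^n\lambda_j=1$. The space $X$ has property CWO if every such $C$ is open in the relative weak topology of $B_X$. A point $x\in B_X$ has property (co) if for every $n\in\mathbb N$, $n\ge2$, the following holds: whenever $x_1,\dots,x_n\in B_X$ and $\lambda_1,\dots,\lambda_n>0$, $\sum_{j=1}^n\lambda_j=1$, are such that $x=\sum_{j=1}^n\lambda_jx_j$, and $\varepsilon>0$, there is a $\delta>0$ such that, setting $B:=B(x,\delta)\cap B_X$, there are (norm-)continuous functions $\widehat v_j:B\to B_X$, $j\in\{1,\dots,n\}$, such that for every $u\in B$ one has $u=\sum_{j=1}^n\lambda_j\widehat v_j(u)$ and $\|\widehat v_j(u)-x_j\|<\varepsilon$ for every $j\in\{1,\dots,n\}$.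 The space $X$ has property (co) if every point $x\in B_X$ has property (co). *)

(* Defs.v *)
From HB Require Import structures.
From mathcomp Require Import all_boot all_order all_algebra.
From mathcomp Require Import complex.
From mathcomp Require Import all_classical all_reals all_analysis.

Set Implicit Arguments.
Unset Strict Implicit.
Unset Printing Implicit Defensive.

Import Order.TTheory GRing.Theory Num.Theory.
Import numFieldNormedType.Exports.

Local Open Scope classical_set_scope.
Local Open Scope ring_scope.

(* A norm on a K-space takes its values in K itself.  In R[i] the relation    *)
(* 0 < a means that a is real and positive, so that the coefficients l j, the *)
(* radii and the norms occurring below are real numbers also when K is R[i].  *)
Variant scalars := Reals | Complexes.

Definition scalar_field (R : realType) (k : scalars) : numFieldType :=
  match k with
  | Reals => R
  | Complexes => R[i]
  end.

Section BanachSpaces.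
Variables (K : numFieldType) (X : completeNormedModType K).

Definition finite_dimensional : Prop :=
  exists (m : nat) (e : 'I_m -> X),
    forall x : X, exists a : 'I_m -> K, x = \sum_(j < m) a j *: e j.

Definition unit_ball : set X := [set x | `|x| <= 1].

Definition dual : Type := {f : {scalar X} | continuous f}.

Definition weak_space : topologicalType :=
  sup_topology (fun f : dual => Topological.class (initial_topology (sval f))).

Definition rel_weakly_open (U : set X) : Prop :=
  exists2 W : set X, @open weak_space W & U = W `&` unit_ball.

Definition convex_comb (n : nat) (l : 'I_n -> K) (U : 'I_n -> set X) : set X :=
  [set x | exists2 u : 'I_n -> X,
             forall j, U j (u j) & x = \sum_(j < n) l j *: u j].

Definition property_CWO : Prop :=
  forall (n : nat) (l : 'I_n -> K) (U : 'I_n -> set X),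
    (forall j, 0 < l j) -> \sum_(j < n) l j = 1 ->
    (forall j, rel_weakly_open (U j)) ->
    rel_weakly_open (convex_comb l U).

Definition property_co_at (x : X) : Prop :=
  forall n : nat, (2 <= n)%N ->
  forall (y : 'I_n -> X) (l : 'I_n -> K),
    (forall j, unit_ball (y j)) ->
    (forall j, 0 < l j) -> \sum_(j < n) l j = 1 ->
    x = \sum_(j < n) l j *: y j ->
  forall eps : K, 0 < eps ->
  exists2 delta : K, 0 < delta &
    let B := ball x delta `&` unit_ball in
    exists v : 'I_n -> X -> X,
      [/\ forall j, {within B, continuous (v j)},
          forall j u, B u -> unit_ball (v j u),
          forall u, B u -> u = \sum_(j < n) l j *: v j u &
          forall j u, B u -> `|v j u - y j| < eps].

Definition property_co : Prop := forall x : X, unit_ball x -> property_co_at x.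

End BanachSpaces.

Section c0.
Variables (K : numFieldType) (X : nat -> completeNormedModType K).

Record c0 : Type := C0 {
  c0_seq :> forall n, X n ;
  c0_cvg : (fun n => `|c0_seq n|) @ \oo --> (0 : K)
}.

HB.instance Definition _ := gen_eqMixin c0.
HB.instance Definition _ := gen_choiceMixin c0.

Lemma c0P (x y : c0) : (forall n, x n = y n) -> x = y.
Proof.
case: x y => [x x0] [y y0] /= xy.
have e : x = y by apply: functional_extensionality_dep.
by subst y; congr C0; exact: Prop_irrelevance.
Qed.

Lemma null_seqP (x : forall n, X n) :
  (fun n => `|x n|) @ \oo --> (0 : K) <->
  forall e : K, 0 < e -> \forall n \near \oo, `|x n| < e.
Proof.
split=> [/cvgr0Pnorm_lt x0 e /x0|x0].
  by apply: filterS => n; rewrite normr_id.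
by apply/cvgr0Pnorm_lt => e /x0; apply: filterS => n; rewrite normr_id.
Qed.

Fact c0_zero_subproof : (fun n => `|0 : X n|) @ \oo --> (0 : K).
Proof. by apply/null_seqP => e e0; apply: nearW => n; rewrite normr0. Qed.

Fact c0_opp_subproof (x : c0) : (fun n => `|- x n|) @ \oo --> (0 : K).
Proof.
apply/null_seqP => e e0; have /null_seqP/(_ _ e0) := c0_cvg x.
by apply: filterS => n; rewrite normrN.
Qed.

Fact c0_add_subproof (x y : c0) : (fun n => `|x n + y n|) @ \oo --> (0 : K).
Proof.
apply/null_seqP => e e0; have e2 : 0 < e / 2 by rewrite divr_gt0.
have /null_seqP/(_ _ e2) := c0_cvg x; have /null_seqP/(_ _ e2) := c0_cvg y.
apply: filterS2 => n ye xe; rewrite (splitr e).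
by rewrite (le_lt_trans (ler_normD _ _))// ltrD.
Qed.

Fact c0_scale_subproof (a : K) (x : c0) :
  (fun n => `|a *: x n|) @ \oo --> (0 : K).
Proof.
apply/null_seqP => e e0; have a0 : 0 < `|a| + 1 by rewrite ltr_wpDl.
have /null_seqP/(_ (e / (`|a| + 1))) := c0_cvg x.
rewrite divr_gt0// => /(_ isT); apply: filterS => n.
rewrite ltr_pdivlMr// normrZ; apply: le_lt_trans.
by rewrite mulrC ler_wpM2l// lerDl.
Qed.

Definition c0_zero := C0 c0_zero_subproof.
Definition c0_opp x := C0 (c0_opp_subproof x).
Definition c0_add x y := C0 (c0_add_subproof x y).
Definition c0_scale a x := C0 (c0_scale_subproof a x).

Fact c0_addA : associative c0_add.
Proof. by move=> x y z; apply: c0P => n /=; rewrite addrA. Qed.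
Fact c0_addC : commutative c0_add.
Proof. by move=> x y; apply: c0P => n /=; rewrite addrC. Qed.
Fact c0_add0 : left_id c0_zero c0_add.
Proof. by move=> x; apply: c0P => n /=; rewrite add0r. Qed.
Fact c0_addN : left_inverse c0_zero c0_opp c0_add.
Proof. by move=> x; apply: c0P => n /=; rewrite addNr. Qed.

HB.instance Definition _ :=
  GRing.isZmodule.Build c0 c0_addA c0_addC c0_add0 c0_addN.

Fact c0_scaleA a b (x : c0) : c0_scale a (c0_scale b x) = c0_scale (a * b) x.
Proof. by apply: c0P => n /=; rewrite scalerA. Qed.
Fact c0_scale1 : left_id 1 c0_scale.
Proof. by move=> x; apply: c0P => n /=; rewrite scale1r. Qed.
Fact c0_scaleDr : right_distributive c0_scale +%R.
Proof. by move=> a x y; apply: c0P => n /=; rewrite scalerDr. Qed.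
Fact c0_scaleDl (x : c0) : {morph c0_scale^~ x : a b / a + b}.
Proof. by move=> a b; apply: c0P => n /=; rewrite scalerDl. Qed.

HB.instance Definition _ :=
  GRing.Zmodule_isLmodule.Build K c0 c0_scaleA c0_scale1 c0_scaleDr c0_scaleDl.

Definition c0_norm (x : c0) : K := supremum 0 (range (fun n => `|x n|)).

Lemma c0_max (x : c0) : exists m, forall n, `|x n| <= `|x m|.
Proof.
have [x0|/existsNP[p /eqP xp]] := pselect (forall n, x n = 0).
  by exists 0%N => n; rewrite !x0 !normr0.
have /null_seqP/(_ `|x p|) := c0_cvg x; rewrite normr_gt0 => /(_ xp)[N _ xN].
have [m _ xm] : exists2 m : 'I_N.+1, true &
    forall n : 'I_N.+1, `|x n| <= `|x m|.
  elim: N {xN} => [|N [m _ IH]]; first by exists ord0 => // n; rewrite (ord1 n).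
  have [le|gt] := real_leP (normr_real (x N.+1)) (normr_real (x m)).
    exists (widen_ord (leqnSn _) m) => // n /=.
    have := ltn_ord n; rewrite ltnS leq_eqVlt => /predU1P[->//|nN].
    exact: (IH (Ordinal nN)).
  exists ord_max => // n /=.
  have := ltn_ord n; rewrite ltnS leq_eqVlt => /predU1P[->//|nN].
  exact/ltW/(le_lt_trans (IH (Ordinal nN))).
have pN : (p < N.+1)%N.
  by rewrite ltnS leqNgt; apply/negP => /ltnW/xN /=; rewrite ltxx.
exists m => n; have [nN|Nn] := ltnP n N.+1; first exact: (xm (Ordinal nN)).
exact/ltW/(lt_le_trans (xN n (ltnW Nn)))/(xm (Ordinal pN)).
Qed.

Lemma c0_norm_max (x : c0) m :
  (forall n, `|x n| <= `|x m|) -> c0_norm x = `|x m|.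
Proof.
move=> xm; rewrite /c0_norm /supremum ifF; last first.
  by apply/negP => /eqP/seteqP[/(_ `|x m|) h _]; apply: h; exists m.
have sm : supremums (range (fun n => `|x n|)) `|x m|.
  by split=> [_ [n _ <-]//|y]; apply; exists m.
by case: xgetP => [_ -> /(is_subset1_supremums sm)//|/(_ _ sm)].
Qed.

Lemma c0_normP (x : c0) : exists2 m, c0_norm x = `|x m| &
  forall n, `|x n| <= c0_norm x.
Proof. by have [m xm] := c0_max x; exists m; rewrite (c0_norm_max xm). Qed.

Fact c0_norm_triangle (x y : c0) : c0_norm (x + y) <= c0_norm x + c0_norm y.
Proof.
have [m -> _] := c0_normP (x + y); have [_ _ xm] := c0_normP x.
have [_ _ ym] := c0_normP y.
by rewrite (le_trans (ler_normD _ _))// lerD.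
Qed.

Fact c0_normZ (a : K) (x : c0) : c0_norm (a *: x) = `|a| * c0_norm x.
Proof.
have [m xm] := c0_max x.
have axm n : `|(a *: x) n| <= `|(a *: x) m|.
  change (`|a *: x n| <= `|a *: x m|); rewrite !normrZ.
  exact: (ler_wpM2l (normr_ge0 a) (xm n)).
by rewrite (c0_norm_max xm) (c0_norm_max axm) -normrZ.
Qed.

Fact c0_norm0_eq0 (x : c0) : c0_norm x = 0 -> x = 0.
Proof.
have [_ _ +] := c0_normP x => /[swap] -> x0; apply: c0P => n.
by apply/eqP; rewrite -normr_le0; exact: x0.
Qed.

HB.instance Definition _ :=
  Lmodule_isNormed.Build K c0 c0_norm_triangle c0_normZ c0_norm0_eq0.

Lemma c0_norm_lt (x : c0) (e : K) : (forall n, `|x n| < e) -> `|x| < e.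
Proof.
by move=> xe; have [m xm _] := c0_normP x; rewrite [`|x|]xm; exact: xe.
Qed.

Lemma le_c0_norm (x : c0) n : `|x n| <= `|x|.
Proof. by have [_ _ xn] := c0_normP x; exact: xn. Qed.

Lemma le_c0_dist (x y : c0) n : `|x n - y n| <= `|x - y|.
Proof. exact: (le_c0_norm (x - y) n). Qed.

Fact c0_complete (F : set_system c0) : ProperFilter F -> cauchy F -> cvg F.
Proof.
move=> FF /(@cauchyP K) Fc.
pose Fn n := (fun x : c0 => x n) @ F.
have PFn n : ProperFilter (Fn n) by exact: fmap_proper_filter.
have cFn n : cvg (Fn n).
  apply: cauchy_cvg; apply/(@cauchyP K (X n)) => e /Fc[x Fx]; exists (x n).
  change (F (fun y : c0 => ball (x n) e (y n))).
  apply: filterS Fx => y; rewrite -!ball_normE/=; apply: le_lt_trans.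
  exact: le_c0_dist.
pose l n := lim (Fn n).
have xl (x : c0) (e : K) n : 0 < e -> F (ball x e) -> `|x n - l n| < e + e.
  move=> e0 Fx.
  have Fl : F (fun y : c0 => ball (l n) e (y n)).
    have := cFn n; move=> /(_ (ball (l n) e)); apply; exact: nbhsx_ballx.
  have [y [xy ly]] := filter_ex (filterI Fx Fl).
  rewrite -(subrKA (y n)) (le_lt_trans (ler_normD _ _))// ltrD//.
    move: xy; rewrite -ball_normE/=; apply: le_lt_trans.
    exact: le_c0_dist.
  by move: ly; rewrite -ball_normE/= distrC.
have e4 (e : K) : 0 < e -> 0 < e / 2 / 2 by move=> e0; rewrite !divr_gt0.
have l0 : (fun n => `|l n|) @ \oo --> (0 : K).
  apply/null_seqP => e e0; have [x Fx] := Fc _ (e4 _ e0).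
  have /null_seqP/(_ (e / 2)) := c0_cvg x; rewrite divr_gt0// => /(_ isT).
  apply: filterS => n xn; rewrite -(subrK (x n) (l n)) (splitr e).
  rewrite (le_lt_trans (ler_normD _ _))// ltrD// distrC [ltRHS]splitr.
  exact: xl (e4 _ e0) Fx.
apply/cvg_ex; exists (C0 l0); apply/cvgrPdist_lt => e e0.
have [x Fx] := Fc _ (e4 _ e0).
apply: filterS (Fx) => y; rewrite -ball_normE/= => xy.
apply: c0_norm_lt => n /=; rewrite distrC -(subrKA (x n)) (splitr e).
rewrite (le_lt_trans (ler_normD _ _))// ltrD//; last first.
  by rewrite [ltRHS]splitr; exact: xl (e4 _ e0) Fx.
rewrite (le_lt_trans (le_c0_dist y x n))// distrC (lt_trans xy)//.
by rewrite [ltRHS]splitr ltrDl !divr_gt0.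
Qed.

HB.instance Definition _ := Uniform_isComplete.Build c0 c0_complete.

End c0.

(* Main.v *)
From HB Require Import structures.
Require Import Defs.
From mathcomp Require Import all_boot all_order all_algebra.
From mathcomp Require Import complex.
From mathcomp Require Import all_classical all_reals all_analysis.

Set Implicit Arguments.
Unset Strict Implicit.
Unset Printing Implicit Defensive.

Import Order.TTheory GRing.Theory Num.Theory.
Import numFieldNormedType.Exports.

Local Open Scope classical_set_scope.
Local Open Scope ring_scope.

(** Why the theorem holds.  Take a point [x = \sum_j l j *: x' j] of a convex
combination of relatively weakly open sets [U j].  On the unit ball of [c0 X]
the weak topology at [x' j] is controlled by finitely many coordinates: a
continuous functional is uniformly small on the elements of the unit ball that
vanish on a long initial segment ([functional_tail_small]), so that for some
[k] every element of the ball whose first [k] coordinates are close to those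
of [x' j] belongs to [U j] ([coordinate_box_weak_cvg]).

Let [N] be such a number of coordinates that serves all the [U j] at once.  If
[y] in the ball has its first [N] coordinates close enough to those of [x],
property (co) of each of the first [N] spaces splits [y n] as
[\sum_j l j *: w n j] with [w n j] close to [x' j n].  Keep [y n] itself in
every later coordinate.  The sequences obtained in this way lie in the unit
ball, belong to the [U j], and have convex combination [y], because the [l j]
add up to [1].

The elements [y] whose first [N] coordinates are close to those of [x] form a
weak neighbourhood of [x].  This is where finite dimension enters: the norm
topology of a finite-dimensional space is given by finitely many bounded
linear functionals ([finite_dimensional_coordinates]), hence the coordinate
maps of [c0 X] are continuous from the weak topology to the norm topology
([coordinate_weak_cvg]).

The argument needs only that the scalar field be Archimedean and complete; both
facts are checked for the real and the complex field, and everything in between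
is proved over an arbitrary such [numFieldType]. *)

(** * Archimedean and complete scalar fields *)

Definition cauchy_complete (K : numFieldType) : Prop :=
  forall F : set_system K, ProperFilter F -> cauchy F -> cvg F.

Definition archimedean (K : numFieldType) : Prop :=
  forall a : K, exists m : nat, `|a| < m%:R.

Lemma scalar_field_archimedean (R : realType) (k : scalars) :
  archimedean (scalar_field R k).
Proof.
case: k => /= a.
  by exists (Num.bound `|a|); exact: archi_boundP.
exists (Num.bound (complex.Re `|a|)).
have a0 : 0 <= complex.Re `|a| by rewrite normc_def/= sqrtr_ge0.
have -> : `|a| = (complex.Re `|a|)%:C%C by rewrite normc_def.
rewrite -[ltRHS](rmorph_nat (real_complex R)) ltcR.
exact: archi_boundP.
Qed.

(** In [R[i]] the real and imaginary parts are maps that do not increase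
distances, so they carry a Cauchy filter to Cauchy filters on [R]; the two
limits are the parts of the limit. *)
Lemma scalar_field_complete (R : realType) (k : scalars) :
  cauchy_complete (scalar_field R k).
Proof.
case: k => /= F FF Fc; first exact: (@cauchy_cvg R).
move/(@cauchyP R[i]) : Fc => Fc.
have cF (p : R[i] -> R) : (forall z w, `|p z - p w|%:C%C <= `|z - w|) ->
    cvg (p @ F).
  move=> pl; apply: cauchy_cvg; apply/(@cauchyP R R) => e e0.
  have [|z Fz] := Fc e%:C%C; first by rewrite ltcR.
  exists (p z); change (F (p @^-1` ball (p z) e)); apply: filterS Fz => w.
  rewrite -!ball_normE/= => zw.
  by have := le_lt_trans (pl z w) zw; rewrite ltcR.
have cRe : cvg (@complex.Re R @ F).
  by apply: cF => z w; rewrite -raddfB normc_ge_Re.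
have cIm : cvg (@complex.Im R @ F).
  apply: cF => z w; rewrite -raddfB normc_def lecR/= -sqrtr_sqr ler_wsqrtr//.
  by rewrite lerDr sqr_ge0.
apply/cvg_ex; exists (lim (@complex.Re R @ F) +i* lim (@complex.Im R @ F))%C.
apply/cvgrPdist_lt => e e0.
(* A positive element of [R[i]] is real. *)
have er : e = (complex.Re e)%:C%C.
  rewrite [LHS]complexE; move: e0; rewrite ltcE/= => /andP[/eqP-> _].
  by rewrite mulr0 addr0.
have r2 : 0 < complex.Re e / 2 by rewrite divr_gt0// -ltcR -er.
have /cvgrPdist_lt/(_ _ r2) h1 := cRe.
have /cvgrPdist_lt/(_ _ r2) h2 := cIm.
near=> z.
rewrite [X in `|X|]complexE (le_lt_trans (ler_normD _ _))//.
have -> : e = (complex.Re e / 2)%:C%C + (complex.Re e / 2)%:C%C.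
  by rewrite -rmorphD/= -splitr.
have nC (r : R) : `|r%:C%C : R[i]| = `|r|%:C%C.
  by rewrite normc_def/= expr0n/= addr0 sqrtr_sqr.
rewrite normrM !nC ltrD//.
  by rewrite raddfB/= ltcR; near: z.
rewrite [X in X * _](_ : _ = 1) ?mul1r.
  by rewrite raddfB/= ltcR; near: z.
by rewrite normc_def/= expr0n/= add0r expr1n sqrtr1.
Unshelve. all: by end_near.
Qed.

(** * Finite-dimensional normed spaces *)

Section FiniteDimension.
Context {K : numFieldType} {X : normedModType K}.

Definition lincomb (e : nat -> X) (m : nat) (a : nat -> K) : X :=
  \sum_(i < m) a i *: e i.

(** The quantitative form of linear independence: the coefficients depend on
the combination, and they do so in a bounded way.  Being a lower bound for the
norm, it passes to limits, which mere independence does not. *)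
Definition bounded_coefficients (e : nat -> X) (m : nat) (C : K) : Prop :=
  forall (a : nat -> K) i, (i < m)%N -> `|a i| <= C * `|lincomb e m a|.

Lemma eq_lincomb e e' m a a' :
  (forall i, (i < m)%N -> e i = e' i) -> (forall i, (i < m)%N -> a i = a' i) ->
  lincomb e m a = lincomb e' m a'.
Proof. by move=> ee' aa'; apply: eq_bigr => i _; rewrite ee'// aa'. Qed.

Lemma lincombD e m a b :
  lincomb e m (fun i => a i + b i) = lincomb e m a + lincomb e m b.
Proof. by rewrite -big_split; apply: eq_bigr => i _; rewrite scalerDl. Qed.

Lemma lincombZ e m c a : lincomb e m (fun i => c * a i) = c *: lincomb e m a.
Proof. by rewrite scaler_sumr; apply: eq_bigr => i _; rewrite scalerA. Qed.

Lemma lincombB e m a b :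
  lincomb e m (fun i => a i - b i) = lincomb e m a - lincomb e m b.
Proof. by rewrite -sumrB; apply: eq_bigr => i _; rewrite scalerBl. Qed.

Lemma lincombS e m a : lincomb e m.+1 a = lincomb e m a + a m *: e m.
Proof. exact: big_ord_recr. Qed.

(** The span is complete, hence closed.  If combinations came arbitrarily close
to [x], the filter of coefficients whose combination is near [x] would be
Cauchy in each coordinate by the bound on the coefficients; the limit
coefficients would then give [x] itself. *)
Lemma span_dist_gt0 e m C x : cauchy_complete K -> 0 <= C ->
  bounded_coefficients e m C -> (forall a, x <> lincomb e m a) ->
  exists2 d : K, 0 < d & forall a, d <= `|x - lincomb e m a|.
Proof.
move=> Kc C0 eC xe; apply: contrapT => nd.
have near_x d : 0 < d -> exists a, `|x - lincomb e m a| < d.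
  move=> d0; apply: contrapT => na; apply: nd; exists d => // a.
  rewrite real_leNgt ?normr_real ?gtr0_real//.
  by apply/negP => ax; apply: na; exists a.
pose F : set_system (nat -> K) :=
  filter_from (nbhs x) (fun U => lincomb e m @^-1` U).
have FF : ProperFilter F.
  apply: filter_from_proper; last first.
    move=> U /nbhs_ballP[d /= /near_x[a xa] dU].
    by exists a; apply: dU; rewrite -ball_normE.
  apply: filter_from_filter; first by exists setT; exact: filterT.
  by move=> U V xU xV; exists (U `&` V) => //; exact: filterI.
have Fx : lincomb e m @ F --> x.
  by move=> U xU; exists U.
have cF i : (i < m)%N -> cvg ((fun a : nat -> K => a i) @ F).
  move=> im; apply: Kc; apply/(@cauchyP K) => d d0.
  have r0 : 0 < d / (C + C + 1) by rewrite divr_gt0// ltr_wpDl// addr_ge0.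
  have [a0 xa0] := near_x _ r0.
  exists (a0 i), (ball x (d / (C + C + 1))); first exact: nbhsx_ballx.
  move=> a /=; rewrite -!ball_normE/= => xa.
  apply: le_lt_trans (eC (fun i => a0 i - a i) i im) _.
  rewrite lincombB -(subrKA x) -(opprB x) addrC.
  have : `|x - lincomb e m a - (x - lincomb e m a0)| <=
         d / (C + C + 1) + d / (C + C + 1).
    by rewrite (le_trans (ler_normB _ _))// lerD// ltW.
  move=> /(ler_wpM2l C0)/le_lt_trans; apply.
  rewrite -mulrDl mulrA ltr_pdivrMr ?ltr_wpDl ?addr_ge0//.
  by rewrite !mulrDr mulr1 (mulrC d) ltrDl.
have /choice[l ll] i : exists l : K, (i < m)%N ->
    (fun a : nat -> K => a i) @ F --> l.
  have [im|_] := ltnP i m; last by exists 0.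
  by exists (lim ((fun a : nat -> K => a i) @ F)) => _; exact: cF.
apply: (xe l); apply: (@cvg_unique _ (@norm_hausdorff K X) _ _ _ _ Fx).
apply: cvg_big => [|i _]; first exact: add_continuous.
by apply: cvgZr_tmp; exact: ll.
Qed.

(** Vectors are added one at a time.  A vector already in the span is dropped;
otherwise its distance [d > 0] to the span bounds its own coefficient by [d^-1]
times the norm of the combination, and subtracting that term bounds the
others. *)
Lemma bounded_coefficients_basis (e : nat -> X) m : cauchy_complete K ->
  exists n (b : nat -> X) (C : K),
    [/\ 0 <= C, bounded_coefficients b n C &
        forall a, exists c, lincomb e m a = lincomb b n c].
Proof.
move=> Kc; elim: m => [|m [n [b [C [C0 bC eb]]]]].
  by exists 0%N, e, 0; split => // a; exists a.
have [[c ec]|ne] := pselect (exists c, e m = lincomb b n c).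
  exists n, b, C; split => // a; have [c' ac'] := eb a.
  exists (fun i => c' i + a m * c i).
  by rewrite lincombS lincombD lincombZ -ec ac'.
have em_notin c : e m <> lincomb b n c by move=> ec; apply: ne; exists c.
have [d d0 dP] := span_dist_gt0 Kc C0 bC em_notin.
pose b' i := if (i < n)%N then b i else e m.
have b'E a : lincomb b' n.+1 a = lincomb b n a + a n *: e m.
  rewrite lincombS {2}/b' ltnn; congr (_ + _).
  by apply: eq_lincomb => // i im; rewrite /b' im.
have last_le a : `|a n| <= d^-1 * `|lincomb b' n.+1 a|.
  rewrite mulrC ler_pdivlMr// b'E.
  have [->|an0] := eqVneq (a n) 0; first by rewrite normr0 mul0r.
  have := dP (fun i => - (a n)^-1 * a i).
  rewrite lincombZ scaleNr opprK => /(ler_wpM2l (normr_ge0 (a n))).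
  by rewrite -normrZ scalerDr scalerA mulfV// scale1r addrC.
exists n.+1, b', (C * (1 + d^-1 * `|e m|) + d^-1); split.
- by rewrite addr_ge0 ?mulr_ge0 ?addr_ge0 ?mulr_ge0// invr_ge0 ltW.
- move=> a i; rewrite ltnS leq_eqVlt mulrDl => /predU1P[->|im].
    rewrite (le_trans (last_le a))// lerDr !mulr_ge0// addr_ge0// mulr_ge0//.
    by rewrite invr_ge0 ltW.
  apply: (le_trans (bC a i im)); rewrite -mulrA.
  apply: (@le_trans _ _ (C * ((1 + d^-1 * `|e m|) * `|lincomb b' n.+1 a|))).
    apply: ler_wpM2l => //.
    have -> : lincomb b n a = lincomb b' n.+1 a - a n *: e m.
      by rewrite b'E addrK.
    rewrite (le_trans (ler_normB _ _))// mulrDl mul1r lerD2l normrZ.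
    by rewrite mulrAC ler_wpM2r.
  by rewrite lerDl mulr_ge0// invr_ge0 ltW.
- move=> a; have [c ac] := eb a.
  exists (fun i => if (i < n)%N then c i else a m).
  rewrite b'E ltnn lincombS ac; congr (_ + _).
  by apply: eq_lincomb => // i ->.
Qed.

End FiniteDimension.

(** Bounded coefficients are unique, hence depend linearly on the vector: these
are the coordinate functionals [g]. *)
Lemma finite_dimensional_coordinates (K : numFieldType)
    (X : completeNormedModType K) : cauchy_complete K -> finite_dimensional X ->
  exists n (b : 'I_n -> X) (g : 'I_n -> X -> K) (C : K),
    [/\ 0 <= C, forall i, scalar (g i), forall i x, `|g i x| <= C * `|x| &
        forall x, x = \sum_(i < n) g i x *: b i].
Proof.
move=> Kc [m [e0 e0P]].
pose e i := oapp e0 0 (insub i).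
have [n [b [C [C0 bC eb]]]] := bounded_coefficients_basis e m Kc.
have /choice[g gP] x : exists c, x = lincomb b n c.
  have [a xa] := e0P x; have [c ac] := eb (fun i => oapp a 0 (insub i)).
  exists c; rewrite -ac {1}xa; apply: eq_bigr => i _.
  by rewrite /e valK.
have g_unique x c i : x = lincomb b n c -> (i < n)%N -> g x i = c i.
  move=> xc im; apply/eqP; rewrite -subr_eq0 -normr_le0.
  have := bC (fun i => g x i - c i) i im.
  by rewrite lincombB -gP -xc subrr normr0 mulr0.
exists n, (fun i => b i), (fun i x => g x i), C; split.
- exact: C0.
- move=> i a x y; apply: (g_unique _ (fun j => a * g x j + g y j)) => //.
  by rewrite lincombD lincombZ -!gP.
- by move=> i x; rewrite [in leRHS](gP x); exact: bC.
- exact: gP.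
Qed.

(** * Convergence in the weak topology *)

Section WeakTopology.
Context {K : numFieldType} {X : completeNormedModType K}.

Lemma weak_cvgP (F : set_system X) (x : X) : Filter F ->
  F --> (x : weak_space X) <-> forall f : dual X, sval f @ F --> sval f x.
Proof.
move=> FF; rewrite /weak_space cvg_sup; split=> xF f.
  by move=> A /(@initial_continuous _ _ (sval f) x) /(xF f).
move=> A; rewrite nbhsE => -[B [[V oV <-] Vx] BA]; apply: filterS BA _.
by apply: xF; exact: open_nbhs_nbhs.
Qed.

Lemma dual_bounded (f : dual X) :
  exists2 C : K, 0 < C & forall x, `|sval f x| <= C * `|x|.
Proof.
have /linear_bounded_continuous/linear_boundedP fC := svalP f.
have C0 : \forall r \near +oo, (0 : K) < r by exact: nbhs_pinfty_gt.
by have [C [? ?]] := filter_ex (filterI C0 fC); exists C.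
Qed.

Lemma dual_of_bounded (g : X -> K) (C : K) : 0 <= C -> scalar g ->
  (forall x, `|g x| <= C * `|x|) -> exists f : dual X, sval f =1 g.
Proof.
move=> C0 lg gC.
pose L := GRing.isLinear.Build K X K *%R g lg.
pose gL : {scalar X} := HB.pack g L.
suff cg : continuous gL by exists (exist _ gL cg).
apply/linear_bounded_continuous/linear_boundedP.
near=> r => x; apply: le_trans (gC x) _.
by apply: ler_wpM2r => //; near: r; apply: nbhs_pinfty_ge; exact: ger0_real.
Unshelve. all: by end_near.
Qed.

End WeakTopology.

(** * Null sequences: functionals and weak neighbourhoods *)

Section NullSequences.
Context {K : numFieldType} {X : nat -> completeNormedModType K}.
Implicit Types x y z : c0 X.

Fact splice_subproof (N : nat) (h : forall n, X n) (z : c0 X) :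
  (fun n => `|if (n < N)%N then h n else z n|) @ \oo --> (0 : K).
Proof.
apply/null_seqP => e e0; have /null_seqP/(_ _ e0) := c0_cvg z.
have : \forall n \near \oo, (N <= n)%N by exists N.
by apply: filterS2 => n; rewrite leqNgt => /negbTE ->.
Qed.

Definition splice N h z : c0 X := C0 (splice_subproof N h z).

Lemma c0_norm_le x (r : K) : (forall n, `|x n| <= r) -> `|x| <= r.
Proof.
by move=> xr; have [m xm _] := c0_normP x; rewrite [`|x|]xm; exact: xr.
Qed.

Lemma splice_approx x (e : K) : 0 < e ->
  exists N, `|x - splice N x 0| < e.
Proof.
move=> e0; have /null_seqP/(_ _ e0)[N _ xN] := c0_cvg x.
exists N; apply: c0_norm_lt => n.
change (`|x n - (if (n < N)%N then x n else 0)| < e).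
case: ltnP => [_|Nn]; first by rewrite subrr normr0.
by rewrite subr0; exact: xN.
Qed.

Lemma splice_head_tail x N : x = splice N x 0 + splice N (0 : c0 X) x.
Proof.
apply: c0P => n.
change (x n = (if (n < N)%N then x n else 0) + (if (n < N)%N then 0 else x n)).
by case: ifP; rewrite ?addr0 ?add0r.
Qed.

(** Gliding hump.  If [f] is at least [e] somewhere on every tail of the unit
ball, then successive elements, cut off so as to have disjoint supports and
rotated so that [f] is positive on them, can be added up: the supremum norm
stays at most [1] while each summand contributes [e / 2] to [f]. *)
Lemma block_sum (f : dual (c0 X)) (e : K) (m : nat) : 0 < e ->
  (forall N, exists y, [/\ `|y| <= 1, forall n, (n < N)%N -> y n = 0 &
                          e <= `|sval f y|]) ->
  exists M y, [/\ `|y| <= 1, forall n, (M <= n)%N -> y n = 0 &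
                 m%:R * (e / 2) <= sval f y].
Proof.
move=> e0 tails; elim: m => [|m [M [y [y1 yM fy]]]].
  by exists 0%N, 0; split; rewrite ?normr0 ?mul0r ?raddf0//.
(* Cutting [z] off may cost half of the value [e]. *)
have [z [z1 zM fz]] := tails M.
have [C C0 fC] := dual_bounded f.
have [|M' zM'] := @splice_approx z (e / 2 / C); first by rewrite !divr_gt0.
set z' := splice M' z 0 in zM'.
have fz' : e / 2 <= `|sval f z'|.
  have : `|sval f z - sval f z'| <= e / 2.
    rewrite -raddfB (le_trans (fC _))// mulrC -ler_pdivlMr//.
    exact: ltW.
  move=> zz'; rewrite -(lerD2r (e / 2)) -splitr (le_trans fz)//.
  rewrite -(subrK (sval f z') (sval f z)) (le_trans (ler_normD _ _))//.
  by rewrite addrC lerD2l.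
have fz'0 : 0 < `|sval f z'| by rewrite (lt_le_trans _ fz')// divr_gt0.
have fz'n : sval f z' != 0 by rewrite -normr_gt0.
(* [t] is the unimodular scalar for which [f (t *: z') = `|f z'|]. *)
pose t := `|sval f z'| / sval f z'.
exists (maxn M M'), (y + t *: z'); split.
- apply: c0_norm_le => n.
  change (`|y n + t *: (if (n < M')%N then z n else 0)| <= 1).
  have [nM|Mn] := ltnP n M.
    rewrite zM// if_same scaler0 addr0; exact: le_trans (le_c0_norm y n) y1.
  rewrite yM// add0r normrZ normrM normfV normr_id divff ?gt_eqF// mul1r.
  case: ifP => _; last by rewrite normr0.
  exact: le_trans (le_c0_norm z n) z1.
- move=> n; rewrite geq_max => /andP[Mn M'n].
  change (y n + t *: (if (n < M')%N then z n else 0) = 0).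
  by rewrite yM// ltnNge M'n scaler0 addr0.
- rewrite raddfD/= linearZ/= -mulrA mulVf// mulr1 -natr1 mulrDl mul1r.
  exact: lerD.
Qed.

(** Otherwise the sums of [block_sum] would make [f] unbounded on the unit
ball. *)
Lemma functional_tail_small (f : dual (c0 X)) (e : K) :
  archimedean K -> 0 < e ->
  exists N, forall y, (forall n, (n < N)%N -> y n = 0) ->
    `|sval f y| <= e * `|y|.
Proof.
move=> Ka e0; apply: contrapT => nN.
have tails N : exists y, [/\ `|y| <= 1, forall n, (n < N)%N -> y n = 0 &
                          e <= `|sval f y|].
  have /existsNP[y /not_implyP[yN /negP]] :
      ~ forall y, (forall n, (n < N)%N -> y n = 0) -> `|sval f y| <= e * `|y|.
    by move=> h; apply: nN; exists N.
  have [->|y0] := eqVneq y 0; first by rewrite raddf0 !normr0 mulr0 lexx.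
  have ny0 : 0 < `|y| by rewrite normr_gt0.
  rewrite -real_ltNge ?normr_real ?gtr0_real ?mulr_gt0// => fy.
  exists (`|y|^-1 *: y); split.
  - by rewrite normrZ normfV normr_id mulVf// gt_eqF.
  - move=> n nN'; change (`|y|^-1 *: y n = 0).
    by rewrite yN// scaler0.
  - rewrite linearZ/= normrM normfV normr_id mulrC ler_pdivlMr//.
    exact: ltW.
have [C C0 fC] := dual_bounded f.
have [m Cm] := Ka (C / (e / 2)).
have [M [y [y1 _ fy]]] := block_sum m e0 tails.
have : m%:R * (e / 2) <= C.
  rewrite (le_trans fy)// (le_trans (real_ler_norm _))//.
    by apply: ger0_real; apply: le_trans fy; rewrite mulr_ge0// divr_ge0// ltW.
  by rewrite (le_trans (fC y))// -[leRHS]mulr1 ler_wpM2l// ltW.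
rewrite -ler_pdivlMr ?divr_gt0// => mC.
by move: Cm; rewrite gtr0_norm ?divr_gt0// => /(le_lt_trans mC); rewrite ltxx.
Qed.

(** A single index governs both the number of coordinates and the precision, so
that the boxes decrease and finitely many of them have a common refinement. *)
Definition coordinate_box x (k : nat) : set (c0 X) :=
  [set y : c0 X | unit_ball y /\
           forall n, (n < k)%N -> `|x n - y n| < k.+1%:R^-1].

Lemma coordinate_box_sub x k l : (k <= l)%N ->
  coordinate_box x l `<=` coordinate_box x k.
Proof.
move=> kl y [y1 yx]; split=> // n nk.
rewrite (lt_le_trans (yx n (leq_trans nk kl)))// lef_pV2 ?posrE//.
by rewrite ler_nat.
Qed.

Lemma coordinate_box_filter x :
  Filter (filter_from setT (coordinate_box x)).
Proof.
apply: filter_fromT_filter; first by exists 0%N.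
move=> k l; exists (maxn k l) => y xy.
by split; apply: coordinate_box_sub xy; rewrite ?leq_maxl ?leq_maxr.
Qed.

(** A functional splits into its action on the first coordinates, where the box
makes the difference small in norm, and on the tail, where the difference has
norm at most [2] and the functional is small by [functional_tail_small]. *)
Lemma coordinate_box_weak_cvg x : archimedean K -> unit_ball x ->
  filter_from setT (coordinate_box x) --> (x : weak_space (c0 X)).
Proof.
move=> Ka x1; have FF := coordinate_box_filter x; apply/weak_cvgP => f.
apply/cvgrPdist_lt => e e0.
have [C C0 fC] := dual_bounded f.
have [|N fN] := @functional_tail_small f (e / 2 / 2) Ka.
  by rewrite !divr_gt0.
have [k Ck] := Ka (C / (e / 2)).
exists (maxn N k) => // y [y1 xy].
change (`|sval f x - sval f y| < e).
rewrite -raddfB (splice_head_tail (x - y) (maxn N k)) raddfD/=.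
rewrite (le_lt_trans (ler_normD _ _))// [ltRHS]splitr ltr_leD//.
  rewrite (le_lt_trans (fC _))// mulrC -ltr_pdivlMr//.
  apply: c0_norm_lt => n.
  change (`|if (n < maxn N k)%N then x n - y n else 0| < e / 2 / C).
  case: ltnP => [nk|_]; last by rewrite normr0 !divr_gt0.
  apply: lt_le_trans (xy n nk) _.
  rewrite -[leRHS]invf_div lef_pV2 ?posrE ?divr_gt0//.
  apply: (@le_trans _ _ `|C / (e / 2)|).
    by rewrite gtr0_norm ?divr_gt0.
  rewrite (le_trans (ltW Ck))// ler_nat ltnW// ltnS leq_maxr//.
apply: le_trans (fN _ _) _ => [n nN|].
  change ((if (n < maxn N k)%N then 0 else x n - y n) = 0).
  by rewrite (leq_trans nN)// leq_maxl.
rewrite -(mulrA (e / 2)) ger_pMr ?divr_gt0// ler_pdivrMl// mulr1.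
apply: c0_norm_le => n.
change (`|if (n < maxn N k)%N then 0 else x n - y n| <= 2).
case: ifP => _; first by rewrite normr0.
rewrite (le_trans (le_c0_dist x y n))// (le_trans (ler_normB _ _))//.
exact: lerD.
Qed.

(** The [n]-th coordinate is a finite sum of fixed vectors whose coefficients
are continuous functionals on [c0 X]. *)
Lemma coordinate_weak_cvg x n : cauchy_complete K -> finite_dimensional (X n) ->
  (fun y : c0 X => y n) @ nbhs (x : weak_space (c0 X)) --> x n.
Proof.
move=> Kc /(finite_dimensional_coordinates Kc)[m [b [g [C [C0 lg gC gb]]]]].
have gn i : exists f : dual (c0 X), sval f =1 (fun y : c0 X => g i (y n)).
  apply: (dual_of_bounded C0) => [a y z|y]; first exact: lg.
  apply: le_trans (gC i _) _; apply: ler_wpM2l => //; exact: le_c0_norm.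
have cg i : (fun y : c0 X => g i (y n)) @ nbhs (x : weak_space (c0 X)) -->
    g i (x n).
  have [f fg] := gn i.
  have := (@weak_cvgP _ _ (nbhs (x : weak_space (c0 X))) x _).1 (fun A => id) f.
  by rewrite fg (funext fg); apply; exact: nbhs_filter.
rewrite (gb (x n)) (_ : (fun y : c0 X => y n) =
  (fun y : c0 X => \sum_(i < m) g i (y n) *: b i)); last first.
  by apply: funext => y; exact: gb.
apply: cvg_big => [|i _]; first exact: add_continuous.
by apply: cvgZr_tmp; exact: cg.
Qed.

End NullSequences.

(** * Convex combinations *)

Section ConvexCombinations.
Context {K : numFieldType} {X : completeNormedModType K}.

Lemma unit_ball_convex m (l : 'I_m -> K) (y : 'I_m -> X) :
  (forall j, 0 < l j) -> \sum_(j < m) l j = 1 ->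
  (forall j, unit_ball (y j)) -> unit_ball (\sum_(j < m) l j *: y j).
Proof.
move=> l0 l1 y1; rewrite /unit_ball/= (le_trans (ler_norm_sum _ _ _))//.
rewrite -[leRHS]l1 ler_sum// => j _.
by rewrite normrZ gtr0_norm// ler_piMr ?(ltW (l0 j))//; exact: y1.
Qed.

(** Property (co) in the form in which it is used: nearby points of the ball
split near the given points.  The case of a single point is included, where
the splitting of [u] is [u] itself. *)
Lemma property_co_near (y : X) m (x : 'I_m -> X) (l : 'I_m -> K) (eps : K) :
  property_co X -> (forall j, unit_ball (x j)) ->
  (forall j, 0 < l j) -> \sum_(j < m) l j = 1 ->
  y = \sum_(j < m) l j *: x j -> 0 < eps ->
  \forall u \near y, unit_ball u ->
    exists w : 'I_m -> X, [/\ forall j, unit_ball (w j),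
      u = \sum_(j < m) l j *: w j & forall j, `|x j - w j| < eps].
Proof.
move=> co x1 l0 l1 yE e0.
case: m x l x1 l0 l1 yE => [|[|m]] x l x1 l0 l1 yE.
- by move: l1; rewrite big_ord0 => /esym/eqP; rewrite oner_eq0.
- move: l1 yE; rewrite !big_ord1 => l1; rewrite l1 scale1r => yE.
  near=> u; move=> u1; exists (fun=> u); split => // [|j].
    by rewrite big_ord1 l1 scale1r.
  have : ball y eps u by near: u; exact: nbhsx_ballx.
  by rewrite -ball_normE (ord1 j) -yE.
- have y1 : unit_ball y by rewrite yE; exact: unit_ball_convex.
  have [d d0 [v [_ v1 vE vx]]] := co y y1 m.+2 isT x l x1 l0 l1 yE eps e0.
  near=> u; move=> u1.
  have Bu : (ball y d `&` @unit_ball K X) u.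
    by split => //; near: u; exact: nbhsx_ballx.
  exists (v ^~ u); split => [j||j]; [exact: v1 | exact: vE|].
  by rewrite distrC; exact: vx.
Unshelve. all: by end_near.
Qed.

End ConvexCombinations.

Lemma c0_sumE (K : numFieldType) (X : nat -> completeNormedModType K) m
    (F : 'I_m -> c0 X) n : (\sum_(j < m) F j) n = \sum_(j < m) F j n.
Proof. by apply: (big_morph (fun x : c0 X => x n)). Qed.

(** Each point of a convex combination is interior to it relative to the ball:
nearby points split through property (co) in finitely many coordinates and
trivially in the others. *)
Lemma c0_property_CWO (K : numFieldType) (X : nat -> completeNormedModType K) :
  archimedean K -> cauchy_complete K ->
  (forall n, finite_dimensional (X n)) -> (forall n, property_co (X n)) ->
  property_CWO (c0 X).
Proof.
move=> Ka Kc Xfin Xco m l U l0 l1 Uo.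
have U_ball j x : U j x -> unit_ball x by have [W _ ->] := Uo j; case.
exists (@interior (weak_space (c0 X))
          [set y | unit_ball y -> convex_comb l U y]).
  exact: open_interior.
apply/seteqP; split => [x [x' Ux' xE]|x [/nbhs_singleton]]; last by [].
have x1 : unit_ball x.
  by rewrite xE; apply: unit_ball_convex => // j; exact: U_ball (Ux' j).
split => //.
have /choice[k kU] j : exists k, coordinate_box (x' j) k `<=` U j.
  have [W oW UW] := Uo j.
  have [W_x x'1] : (W `&` @unit_ball K (c0 X)) (x' j) by rewrite -UW.
  have [k _ kW] : filter_from setT (coordinate_box (x' j)) W.
    apply: coordinate_box_weak_cvg => //; exact: open_nbhs_nbhs.
  by exists k => y ky; rewrite UW; split; [exact: kW | case: ky].
pose N := \max_(j < m) k j.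
have near_n (n : 'I_N) : \forall y \near (x : weak_space (c0 X)),
    unit_ball ((y : c0 X) n) ->
    exists w : 'I_m -> X n, [/\ forall j, unit_ball (w j),
      (y : c0 X) n = \sum_(j < m) l j *: w j &
      forall j, `|x' j n - w j| < N.+1%:R^-1].
  have x'1 j : unit_ball (x' j n).
    exact: le_trans (le_c0_norm _ _) (U_ball _ _ (Ux' j)).
  have xnE : x n = \sum_(j < m) l j *: x' j n by rewrite xE c0_sumE.
  have eps0 : (0 : K) < N.+1%:R^-1 by rewrite invr_gt0.
  have := property_co_near (Xco n) x'1 l0 l1 xnE eps0.
  by move=> /(coordinate_weak_cvg Kc (Xfin n)).
apply: filterS (filter_forall _ near_n) => y yN y1.
have h n : exists w : 'I_m -> X n, (n < N)%N ->
   [/\ forall j, unit_ball (w j), y n = \sum_(j < m) l j *: w j &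
      forall j, `|x' j n - w j| < N.+1%:R^-1].
  have [nN|_] := ltnP n N; last by exists (fun=> 0).
  have [|w ?] := yN (Ordinal nN); last by exists w.
  exact: le_trans (le_c0_norm _ _) y1.
(* The spaces [X n] vary with [n], so the splittings are chosen dependently. *)
pose w n := projT1 (cid (h n)).
have wP n : (n < N)%N -> _ := projT2 (cid (h n)).
exists (fun j => splice N (fun n => w n j) y) => [j|].
  apply: (kU j); apply: (@coordinate_box_sub _ _ _ _ N).
    exact: leq_bigmax.
  split=> [|n nN].
    apply: c0_norm_le => n.
    change (`|if (n < N)%N then w n j else y n| <= 1).
    case: ifP => [/wP[w1 _ _]|_]; first exact: w1.
    exact: le_trans (le_c0_norm _ _) y1.
  change (`|x' j n - (if (n < N)%N then w n j else y n)| < N.+1%:R^-1).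
  by rewrite nN; have [_ _] := wP _ nN; exact.
apply: c0P => n; rewrite c0_sumE.
change (y n = \sum_(j < m) l j *: (if (n < N)%N then w n j else y n)).
have [nN|_] := ltnP n N; first by have [_ wE _] := wP _ nN.
by rewrite -scaler_suml l1 scale1r.
Qed.

Theorem theorem5p2 (R : realType) (k : scalars)
    (X : nat -> completeNormedModType (scalar_field R k))
    (X_fin : forall n : nat, finite_dimensional (X n))
    (X_co : forall n : nat, property_co (X n)) :
  property_CWO (c0 X).
Proof.
apply: c0_property_CWO => //.
- exact: scalar_field_archimedean.
- exact: scalar_field_complete.
Qed.
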